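(* Let $\Phi\subset N_\mathbb{R}$ be a compact convex domain with non-empty interior, let $\mathcal{F}_\Phi$ be its tropical distance series, $t_\Phi=\max_\Phi \mathcal{F}_\Phi$ its final time, and $\mathcal{K}_\Phi$ its tropical caustic. Let $p$ be a vertex of $\mathcal{K}_\Phi$ which is non-final, i.e. $0<\mathcal{F}_\Phi(p)<t_\Phi$. Then $p$ is a trivalent vertex of $\mathcal{K}_\Phi$, and there exist a natural number $n\geq 1$ and a lattice basis $e_1,e_2$ of $N$ such that, in a small neighbourhood of $p$, $\mathcal{K}_\Phi$ is the union of exactly three segments emanating from $p$: \begin{itemize} \item one in the primitive direction $e_2$, of weight $n$, \item one in the primitive direction $-e_1-n e_2$, of weight $1$, \item one in the primitive direction $e_1$, of weight $1$; \end{itemize} moreover $\mathcal{F}_\Phi<\mathcal{F}_\Phi(p)$ on the first two segments (other than at $p$) and $\mathcal{F}_\Phi>\mathcal{F}_\Phi(p)$ on the third one. In the language of the particle process: a non-final collision involves exactly two particles, one of mass $n\ge 1$ and one of mass $1$, and produces a single particle of mass $1$ (so at most one of the colliding particles has mass greater than one). Equivalently, the dual polygon of $p$ (the convex hull of the gradients of $\mathcal{F}_\Phi$ on the regions adjacent to $p$) is, up to translation and lattice automorphism of $M$, the triangle with vertices $(0,0),(0,1),(-n,1)$, an $A_n$-type triangle of area $n/2$.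
   Context: $N$ is a rank-two lattice, $N_\mathbb{R}=N\otimes\mathbb{R}$, and $M=\operatorname{Hom}(N,\mathbb{Z})$ is the dual lattice. For a compact convex domain $\Phi\subset N_\mathbb{R}$, the tropical distance series is $\mathcal{F}_\Phi(x)=\min_{\lambda\in M\setminus\{0\}}\big(\lambda(x)-\min_{q\in\Phi}\lambda(q)\big)$ for $x\in\Phi$, i.e. the minimum of all support functions of $\Phi$ with integral gradient; it is non-negative on $\Phi$ and vanishes on $\partial\Phi$. The tropical propagation of $\Phi$ at time $t\ge0$ is $\Phi(t)=\{x\in\Phi:\mathcal{F}_\Phi(x)\geq t\}$ (equivalently, the intersection of all rational-slope support half-planes $\{\lambda\ge c\}$ of $\Phi$, $\lambda\in M$ primitive, shifted to $\{\lambda\ge c+t\}$), and the tropical wave front is $\partial\Phi(t)=\mathcal{F}_\Phi^{-1}(t)$; the final time $t_\Phi$ is the maximal $t$ with $\Phi(t)\neq\emptyset$. The tropical caustic $\mathcal{K}_\Phi$ is the corner locus of $\mathcal{F}_\Phi$ in the interior of $\Phi$: the set of points where the minimum defining $\mathcal{F}_\Phi$ is attained by at least two distinct gradients (equivalently, the locus of vertices, i.e. special points, of the wave fronts $\partial\Phi(t)$, $t>0$, together with $\Phi(t_\Phi)$ when the latter is a segment). It is a graph with straight rational-slope edges; the weight of an edge is the lattice length of the difference of the two gradients of $\mathcal{F}_\Phi$ on either side of it, and the edges are balanced at every interior vertex. A vertex of $\mathcal{K}_\Phi$ is a point of $\mathcal{K}_\Phi$ near which $\mathcal{K}_\Phi$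 is not a single straight segment. Particle process: vertices of the wave front $\partial\Phi(t)$ are viewed as particles moving along edges of $\mathcal{K}_\Phi$ as $t$ increases, with mass equal to the edge weight and primitive velocity; at a collision momentum (mass times primitive velocity) is conserved. *)

(* Defs.v *)
(* N = Z^2 (int*int), N_R = R^2 (R*R),
   M = Hom(N,Z) identified with Z^2 via the standard pairing. *)
From HB Require Import structures.
From mathcomp Require Import all_boot all_order all_algebra.
From mathcomp Require Import all_classical all_reals all_analysis.
Set Implicit Arguments. Unset Strict Implicit. Unset Printing Implicit Defensive.
Import Order.TTheory GRing.Theory Num.Theory.
Import numFieldNormedType.Exports.
Local Open Scope classical_set_scope.
Local Open Scope ring_scope.

Section TropDefs.
Variable R : realType.

Definition lam_app (l : int * int) (x : R * R) : R :=
  (l.1)%:~R * x.1 + (l.2)%:~R * x.2.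

Definition supp_val (Phi : set (R * R)) (l : int * int) : R :=
  inf [set lam_app l q | q in Phi].

Definition tdist (Phi : set (R * R)) (x : R * R) : R :=
  inf [set lam_app l x - supp_val Phi l | l in [set l : int * int | l != (0%Z, 0%Z)]].

Definition final_time (Phi : set (R * R)) : R := sup (tdist Phi @` Phi).

Definition attains (Phi : set (R * R)) (x : R * R) (l : int * int) : Prop :=
  l != (0%Z, 0%Z) /\ lam_app l x - supp_val Phi l = tdist Phi x.

Definition caustic (Phi : set (R * R)) : set (R * R) :=
  [set x | @interior (R * R)%type Phi x /\
     exists l1 l2 : int * int, l1 != l2 /\ attains Phi x l1 /\ attains Phi x l2].

Definition convex_dom (Phi : set (R * R)) : Prop :=
  forall x y, Phi x -> Phi y -> forall t : R, 0 <= t <= 1 ->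
    Phi (t * x.1 + (1 - t) * y.1, t * x.2 + (1 - t) * y.2).

Definition box (p : R * R) (e : R) : set (R * R) :=
  [set x | `|x.1 - p.1| < e /\ `|x.2 - p.2| < e].

Definition move_pt (p d : R * R) (s : R) : R * R := (p.1 + s * d.1, p.2 + s * d.2).

Definition lat (v : int * int) : R * R := ((v.1)%:~R, (v.2)%:~R).

Definition ray (p d : R * R) : set (R * R) := [set x | exists s : R, 0 <= s /\ x = move_pt p d s].
Definition line (p d : R * R) : set (R * R) := [set x | exists s : R, x = move_pt p d s].

Definition is_vertex (K : set (R * R)) (p : R * R) : Prop :=
  K p /\ ~ (exists e : R, 0 < e /\ exists d : R * R, d != (0, 0) /\
              K `&` box p e = line p d `&` box p e).

Definition cross (d v : R * R) : R := d.1 * v.2 - d.2 * v.1.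

Definition gradient_on (Phi : set (R * R)) (U : set (R * R)) (l : int * int) : Prop :=
  exists c : R, forall y, U y -> tdist Phi y = lam_app l y - c.

Definition side_plus (x d : R * R) (e : R) : set (R * R) :=
  box x e `&` [set y | 0 < cross d (y.1 - x.1, y.2 - x.2)].
Definition side_minus (x d : R * R) (e : R) : set (R * R) :=
  box x e `&` [set y | cross d (y.1 - x.1, y.2 - x.2) < 0].

End TropDefs.

Definition lattice_length (v : int * int) : nat := gcdn `|v.1|%N `|v.2|%N.

Definition vsub (a b : int * int) : int * int := ((a.1 - b.1)%R, (a.2 - b.2)%R).

Definition edge_weight {R : realType} (Phi : set (R * R)) (x d : R * R) (w : nat) : Prop :=
  exists lp lm : int * int, exists e : R, 0 < e /\
    gradient_on Phi (side_plus x d e) lp /\ gradient_on Phi (side_minus x d e) lm /\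
    lattice_length (vsub lp lm) = w.

Definition det2 (a b : int * int) : int := (a.1 * b.2 - a.2 * b.1)%R.

(* Main.v *)
(** Let [t] be the value of the distance series at [p], and let [S] be the set of
    covectors attaining the minimum there.  The map [l |-> l(p) - min_Phi l] is
    positive, subadditive and positively homogeneous, so [S] is the set of
    shortest nonzero lattice vectors of an asymmetric norm; in particular a
    lattice point of the cone over [S] is never shorter than [t].  A point [q]
    with a larger value than [p] pairs positively (through [q - p]) with every
    element of [S], so [S] lies in an open half-plane and has two extreme
    elements [a] and [b].  The triangle [0, a, b] has no lattice points outside
    [0] and the edge [a, b], so that edge splits into unimodular steps.  Either
    [S] is contained in the edge, and then the caustic is a straight line near
    [p], or some element of [S] lies beyond it; in the latter case the edge has
    lattice length one and, up to exchanging [a] and [b],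
    [S = {a, b, b + a, ..., b + n a}].  Since only finitely many covectors matter
    near [p], the series is locally [t + min(X, Y, Y + n X)] in the coordinates
    [X = a], [Y = b] centred at [p]. *)
Require Import Defs.
From HB Require Import structures.
From mathcomp Require Import all_boot all_order all_algebra.
From mathcomp Require Import all_classical all_reals all_analysis.
From mathcomp Require Import zify ring lra.
Import Order.TTheory GRing.Theory Num.Theory.
Import numFieldNormedType.Exports.
Local Open Scope classical_set_scope.
Local Open Scope ring_scope.
Set Implicit Arguments.
Unset Strict Implicit.
Unset Printing Implicit Defensive.

(** * Minimal lattice vectors of a planar norm *)

(* The arithmetic trace left on its minimal vectors by a norm: a point of the
   cone over three of them cannot be shorter than they are. *)
Definition norm_minimal (S : set (int * int)) : Prop :=
  forall (k i j h : int) (u l m s : int * int),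
    0 < k -> 0 <= i -> 0 <= j -> 0 <= h -> u != (0, 0) ->
    S l -> S m -> S s ->
    k * u.1 = i * l.1 + j * m.1 + h * s.1 ->
    k * u.2 = i * l.2 + j * m.2 + h * s.2 ->
    k <= i + j + h /\ (k = i + j + h -> S u).

Lemma cramer2 (a b s : int * int) : det2 a b = 1 ->
  s = (det2 s b * a.1 + det2 a s * b.1, det2 s b * a.2 + det2 a s * b.2).
Proof.
rewrite /det2 => ab; rewrite [LHS]surjective_pairing; congr pair.
  transitivity (s.1 * (a.1 * b.2 - a.2 * b.1)); last by ring.
  by rewrite ab mulr1.
transitivity (s.2 * (a.1 * b.2 - a.2 * b.1)); last by ring.
by rewrite ab mulr1.
Qed.

(** Dividing [s] by the gcd of its coordinates gives a lattice vector that may not be shorter than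
    the minimum, so the gcd is 1 and Bezout supplies the second basis vector. *)
Lemma norm_minimal_primitive (S : set (int * int)) (s : int * int) :
  norm_minimal S -> S s -> s != (0, 0) -> exists u : int * int, det2 s u = 1.
Proof.
move=> SK Ss s0.
have g0 : 0 < gcdz s.1 s.2.
  rewrite lt_neqAle andbT eq_sym gcdz_eq0.
  by apply: contra s0 => /andP[/eqP s1 /eqP s2]; rewrite [s]surjective_pairing s1 s2.
have [a sa] := dvdzP (dvdz_gcdl s.1 s.2).
have [b sb] := dvdzP (dvdz_gcdr s.1 s.2).
have u0 : (a, b) != (0, 0).
  apply: contra s0 => /eqP[a0 b0].
  by rewrite [s]surjective_pairing sa sb a0 b0 !mul0r.
have := SK (gcdz s.1 s.2) 1 0 0 (a, b) s s s g0 isT isT isT u0 Ss Ss Ss.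
rewrite /= -!(mulrC a) -!(mulrC b) -sa -sb !mul0r !mul1r !addr0.
move=> /(_ erefl erefl)[g1 _].
have [x [y xy]] := Bezoutz s.1 s.2.
exists (- y, x); rewrite /det2 /=.
have -> : s.1 * x - s.2 * - y = x * s.1 + y * s.2 by ring.
by rewrite xy; lia.
Qed.

Lemma norm_minimal_parallel (S : set (int * int)) (s : int * int) (z : int) :
  norm_minimal S -> s != (0, 0) -> S (z * s.1, z * s.2) -> 0 < z -> z = 1.
Proof.
move=> SK s0 Ss z0.
have [||h _] := SK z 1 0 0 s _ _ _ z0 isT isT isT s0 Ss Ss Ss => /=; [ring|ring|].
lia.
Qed.

(** Complete [a] to a basis by a vector [u], chosen modulo [a] so that [D u = r a + b] with
    [0 <= r < D]. Unless [r = D - 1], the point [u] lies strictly between the origin and the line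
    through [a] and [b], which is too short. So [u] is on the edge and [f = u - a] is its unit
    step. *)
Lemma norm_minimal_edge (S : set (int * int)) (a b : int * int) :
  norm_minimal S -> S a -> S b -> 0 < det2 a b ->
  exists f : int * int, det2 a f = 1 /\
    b = (a.1 + det2 a b * f.1, a.2 + det2 a b * f.2).
Proof.
move=> SK Sa Sb D0.
have a0 : a != (0, 0).
  by apply: contraTneq D0 => ->; rewrite /det2 /= !mul0r subr0.
have [u0 au0] := norm_minimal_primitive SK Sa a0.
pose D := det2 a b; pose al := det2 b u0.
have bE := cramer2 b au0.
pose q := (- al %/ D)%Z; pose r := (- al %% D)%Z.
have Dn0 : D != 0 by rewrite gt_eqF.
have alE : - al = q * D + r by exact: divz_eq.
have r0 : 0 <= r by exact: modz_ge0.
have rD : r < D by rewrite -[X in _ < X](gtr0_norm D0) ltz_mod.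
pose u := (u0.1 - q * a.1, u0.2 - q * a.2).
have au : det2 a u = 1 by rewrite -au0 /det2 /=; ring.
have un0 : u != (0, 0).
  by apply/eqP => uE; move: au; rewrite uE /det2 /= !mulr0 subr0.
have alE' : al = - (q * D + r) by rewrite -alE opprK.
have e1 : D * u.1 = r * a.1 + 1 * b.1 + 0 * a.1.
  by rewrite [in RHS]bE /= -/al -/D alE'; ring.
have e2 : D * u.2 = r * a.2 + 1 * b.2 + 0 * a.2.
  by rewrite [in RHS]bE /= -/al -/D alE'; ring.
have [Dr _] := SK D r 1 0 u a b a D0 r0 isT isT un0 Sa Sb Sa e1 e2.
have rE : r = D - 1 by lia.
exists (u.1 - a.1, u.2 - a.2); split.
  by rewrite -au /det2 /=; ring.
rewrite -/D [b]surjective_pairing /=; congr pair.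
  by rewrite mulrBr e1 rE; ring.
by rewrite mulrBr e2 rE; ring.
Qed.

(* If the extreme vectors a and b are at lattice distance D >= 2 on their line,
   then a + f would be strictly shorter than the minimum as soon as some
   minimal vector lies beyond that line. *)
Lemma norm_minimal_long_edge (S : set (int * int)) (a f s : int * int) (D : int) :
  norm_minimal S -> det2 a f = 1 -> 1 < D -> S a ->
  S (a.1 + D * f.1, a.2 + D * f.2) -> S s ->
  0 <= det2 a s -> 0 <= det2 s (a.1 + D * f.1, a.2 + D * f.2) ->
  det2 s f <= 1.
Proof.
move=> SK af D1 Sa Sb Ss y0 yD; rewrite leNgt; apply/negP => x1.
set x := det2 s f in x1; set y := det2 a s in y0.
have sE := cramer2 s af; rewrite -/x -/y in sE.
have yxD : y <= D * x.
  rewrite -subr_ge0; apply: le_trans yD _.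
  by rewrite le_eqVlt; apply/orP; left; apply/eqP; rewrite /x /y /det2 /=; ring.
(* With [b = a + D f], the certificate is [D^2 x (a + f) = (D (D x - x) - (D x - y)) a + (D x - y) b
   + D s]. Its weights add up to [D^2 x - D (x - 1)], which is too small when [x > 1]. *)
have N0 : 0 < D * (D * x) by nia.
have un0 : (a.1 + f.1, a.2 + f.2) != (0, 0).
  apply/eqP => -[u1 u2].
  have : det2 a (a.1 + f.1, a.2 + f.2) = 1 by rewrite -af /det2 /=; ring.
  by rewrite u1 u2 /det2 /= !mulr0 subr0.
have i0 : 0 <= D * (D * x - x) - (D * x - y) by nia.
have j0 : 0 <= D * x - y by lia.
have D0 : 0 <= D by lia.
have [||] := SK (D * (D * x)) _ _ _ _ _ _ _ N0 i0 j0 D0 un0 Sa Sb Ss.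
- by rewrite [in RHS]sE /=; ring.
- by rewrite [in RHS]sE /=; ring.
by move=> h _; nia.
Qed.

(** On the boundary of the cone [s] is a multiple of [a] or [b], hence equal to it. If both
    coordinates of [s = x a + y b] exceeded 1, then [a + b] would be too short:
    [x (a + b) = s + (x - y) b] when [y <= x], and symmetrically otherwise. *)
Lemma norm_minimal_unimodular (S : set (int * int)) (a b s : int * int) :
  norm_minimal S -> det2 a b = 1 -> S a -> S b -> S s -> s != (0, 0) ->
  0 <= det2 a s -> 0 <= det2 s b ->
  [\/ s = a, s = b, 0 < det2 s b /\ det2 a s = 1 | det2 s b = 1 /\ 0 < det2 a s].
Proof.
move=> SK ab Sa Sb Ss s0.
set x := det2 s b; set y := det2 a s => y0 x0.
have sE := cramer2 s ab; rewrite -/x -/y in sE.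
have abn0 : (a.1 + b.1, a.2 + b.2) != (0, 0).
  apply/eqP => -[u1 u2].
  have : det2 a (a.1 + b.1, a.2 + b.2) = 1 by rewrite -ab /det2 /=; ring.
  by rewrite u1 u2 /det2 /= !mulr0 subr0.
have nz0 (u v : int * int) : det2 u v = 1 -> u != (0, 0).
  by move=> uv; apply/eqP => u0; move: uv; rewrite u0 /det2 /= !mul0r subr0.
have prim (z : int) (c : int * int) : 0 <= z -> c != (0, 0) -> S c ->
    s = (z * c.1, z * c.2) -> z = 1.
  move=> z0 c0 Sc scE.
  have zn0 : 0 < z.
    rewrite lt_neqAle z0 andbT; apply: contra s0 => /eqP zE.
    by rewrite scE -zE !mul0r.
  by apply: (norm_minimal_parallel SK c0 _ zn0); rewrite -scE.
have b0 : b != (0, 0).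
  by apply/eqP => b0; move: ab; rewrite b0 /det2 /= !mulr0 subr0.
have [x00|xn0] := eqVneq x 0.
  have y1 : y = 1 by apply: (prim y b) => //; rewrite {1}sE x00; congr pair; ring.
  by constructor 2; rewrite sE x00 y1 !mul0r !mul1r !add0r -surjective_pairing.
have [y00|yn0] := eqVneq y 0.
  have x1 : x = 1.
    by apply: (prim x a) => //; [exact: nz0 ab|rewrite {1}sE y00; congr pair; ring].
  by constructor 1; rewrite sE y00 x1 !mul0r !mul1r !addr0 -surjective_pairing.
have xp : 0 < x by rewrite lt_neqAle eq_sym xn0.
have yp : 0 < y by rewrite lt_neqAle eq_sym yn0.
have [x1|x1] := leP x 1; first by constructor 4; split => //; lia.
have [y1|y1] := leP y 1; first by constructor 3; split => //; lia.
exfalso; have [xy|xy] := leP y x.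
  have xy0 : 0 <= x - y by rewrite subr_ge0.
  have [||h _] := SK x 1 (x - y) 0 _ _ _ _ xp isT xy0 isT abn0 Ss Sb Sb.
  - by rewrite [in RHS]sE /=; ring.
  - by rewrite [in RHS]sE /=; ring.
  by lia.
have yx0 : 0 <= y - x by rewrite subr_ge0 ltW.
have [||h _] := SK y 1 (y - x) 0 _ _ _ _ yp isT yx0 isT abn0 Ss Sa Sa.
- by rewrite [in RHS]sE /=; ring.
- by rewrite [in RHS]sE /=; ring.
by lia.
Qed.

(** * The two possible shapes of the set of minimal vectors *)

Definition segment_like (S : set (int * int)) : Prop :=
  exists (l f : int * int) (D : int), [/\ f != (0, 0), 0 < D, S l,
    S (l.1 + D * f.1, l.2 + D * f.2) &
    forall s, S s -> exists i : int, 0 <= i <= D /\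
      s = (l.1 + i * f.1, l.2 + i * f.2)].

(** The convex hull of [S] is then the dual polygon of area [n/2], with corners [a], [b], [b + n a].
    Inner lattice points of the long edge may or may not belong to [S]; the corners alone determine
    the minimum of the linear forms. *)
Definition triangle_like (S : set (int * int)) : Prop :=
  exists (a b : int * int) (n : nat),
    [/\ det2 a b = 1 \/ det2 a b = -1, (0 < n)%N, S a /\ S b,
    S (b.1 + n%:Z * a.1, b.2 + n%:Z * a.2) &
    forall s, S s -> s = a \/ exists i : int, 0 <= i <= n%:Z /\
      s = (b.1 + i * a.1, b.2 + i * a.2)].

Lemma triangle_like_of_max (S : set (int * int)) (a b : int * int) (B : int) :
  det2 a b = 1 \/ det2 a b = -1 ->
  (forall s, S s -> `|s.1| <= B /\ `|s.2| <= B) -> S a -> S b ->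
  (forall s, S s -> s = a \/ exists i : int, 0 <= i /\
      s = (b.1 + i * a.1, b.2 + i * a.2)) ->
  (exists i : int, 0 < i /\ S (b.1 + i * a.1, b.2 + i * a.2)) ->
  triangle_like S.
Proof.
move=> ab SB Sa Sb Sall [i [i0 Si]].
pose P (k : nat) := `[< S (b.1 + k%:Z * a.1, b.2 + k%:Z * a.2) >].
have Pi : exists k, P k by exists `|i|%N; apply/asboolP; rewrite gtz0_abs.
(* Some coordinate of [a] is a nonzero integer; in that coordinate [k] is at most the size of [k a],
   the difference of two vectors of [S]. *)
have Pmax k : P k -> (k <= `|(B + B)%R|)%N.
  move=> /asboolP /SB /= [k1 k2]; have [b1 b2] := SB _ Sb.
  have [a0|a0] := eqVneq a.1 0.
    have [a0'|a0'] := eqVneq a.2 0; last by nia.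
    by exfalso; case: ab; rewrite /det2 a0 a0'; lia.
  by nia.
pose n := ex_maxn Pi Pmax; have [Pn nmax] : P n /\ forall k, P k -> (k <= n)%N.
  by rewrite /n; case: ex_maxnP.
exists a, b, n; split => //.
- have : P `|i|%N by apply/asboolP; rewrite gtz0_abs.
  by move/nmax; lia.
- exact/asboolP.
move=> s Ss; have [->|[j [j0 sE]]] := Sall _ Ss; [by left|right].
exists j; split => //; rewrite j0 /=.
have : P `|j|%N by apply/asboolP; rewrite gez0_abs // -sE.
by move/nmax; lia.
Qed.

(** The number [det2 s f] is the level of [s] above the origin, the edge from [a] to [b] being at
    level 1. If no level exceeds 1, [S] lies on the edge. Otherwise [D = 1], and in the basis
    [(a, b)] every minimal vector of the open cone has a coordinate equal to 1; what remains is that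
    one and the same coordinate serves them all. *)
Lemma norm_minimal_classification (S : set (int * int)) (a b : int * int) (B : int) :
  norm_minimal S -> (forall s, S s -> s != (0, 0)) ->
  (forall s, S s -> `|s.1| <= B /\ `|s.2| <= B) ->
  S a -> S b -> 0 < det2 a b ->
  (forall s, S s -> 0 <= det2 a s /\ 0 <= det2 s b) ->
  segment_like S \/ triangle_like S.
Proof.
move=> SK Sn0 SB Sa Sb D0 Sext.
have [f [af bE]] := norm_minimal_edge SK Sa Sb D0.
set D := det2 a b in D0 bE.
have f0 : f != (0, 0).
  by apply/eqP => f0; move: af; rewrite f0 /det2 /= !mulr0 subr0.
have seg : (forall s, S s -> det2 s f <= 1) -> segment_like S.
  move=> S1; exists a, f, D; split => //; first by rewrite -bE.
  move=> s Ss; have [y0 yD] := Sext _ Ss; exists (det2 a s).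
  have sE := cramer2 s af; have x1 := S1 _ Ss.
  have xE : det2 s b = D * det2 s f - det2 a s.
    by rewrite [in LHS]bE /det2 /=; ring.
  rewrite xE in yD.
  (* At level at most 0, the cone inequalities [0 <= y <= D x] would force [s = 0]. *)
  have x1E : det2 s f = 1.
    have [x0|x0] := leP (det2 s f) 0; last by lia.
    have y00 : det2 a s = 0 by nia.
    have x00 : det2 s f = 0 by nia.
    by have := Sn0 _ Ss; rewrite sE x00 y00 !mul0r !addr0 eqxx.
  by split; [lia|rewrite {1}sE x1E !mul1r].
have [D1|D1] := leP D 1; last first.
  left; apply: seg => s Ss; have [y0 yD] := Sext _ Ss.
  by apply: (norm_minimal_long_edge SK af D1 Sa _ Ss y0); rewrite -bE.
have ab : det2 a b = 1 by rewrite -/D; lia.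
have U s (Ss : S s) := norm_minimal_unimodular SK ab Sa Sb Ss (Sn0 _ Ss)
  (Sext _ Ss).1 (Sext _ Ss).2.
have ba : det2 b a = -1 by rewrite -ab /det2; ring.
have bb : det2 b b = 0 by rewrite /det2; ring.
have aa : det2 a a = 0 by rewrite /det2; ring.
have [[c [Sc [c1 c2]]]|noc] := pselect (exists c, S c /\ 0 < det2 c b /\ 0 < det2 a c);
  last first.
  left; exists a, (b.1 - a.1, b.2 - a.2), 1; split => //.
  - apply/eqP => -[e1 e2].
    have : det2 a (b.1 - a.1, b.2 - a.2) = 1 by rewrite -ab /det2 /=; ring.
    by rewrite e1 e2 /det2 /= !mulr0 subr0.
  - by rewrite !mul1r !subrKC -surjective_pairing.
  move=> s Ss; have [->|->|[x0 y1]|[x1 y0]] := U _ Ss.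
  - by exists 0; rewrite !mul0r !addr0 -surjective_pairing.
  - by exists 1; rewrite !mul1r !subrKC -surjective_pairing.
  - by exfalso; apply: noc; exists s; rewrite x0 y1.
  - by exfalso; apply: noc; exists s; rewrite x1 y0.
right; have [ally|] := pselect (forall s, S s -> det2 a s <= 1).
  apply: (@triangle_like_of_max S a b B) => //; first by left.
    move=> s Ss; have [->|->|[x0 y1]|[x1 y0]] := U _ Ss.
    - by left.
    - by right; exists 0; rewrite !mul0r !addr0 -surjective_pairing.
    - right; exists (det2 s b); split; first exact: ltW.
      by rewrite {1}(cramer2 s ab) y1; congr pair; ring.
    - right; exists 1; split => //; have y1 : det2 a s = 1 by have := ally _ Ss; lia.
      by rewrite {1}(cramer2 s ab) y1 x1; congr pair; ring.
  exists (det2 c b); split => //.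
  have y1 : det2 a c = 1 by have := ally _ Sc; lia.
  have := cramer2 c ab; rewrite y1 => cE.
  by rewrite (_ : (_, _) = c) // {3}cE; congr pair; ring.
move=> /existsNP[c' /not_implyP[Sc' /negP]]; rewrite -ltNge => c'y.
have c'x : det2 c' b = 1.
  by have [e|e|[_ e]|[]//] := U _ Sc'; move: c'y; rewrite e ?aa ?ab.
(* Vectors [s = x a + b] and [c' = a + y b] with [x, y > 1] cannot coexist: [(x y - 1) (a + b) = (y
   - 1) s + (x - 1) c'] has weights of sum below [x y - 1]. So here the triangle has [a] and [b]
   exchanged. *)
have allx s : S s -> det2 s b <= 1.
  move=> Ss; rewrite leNgt; apply/negP => x1.
  have y1 : det2 a s = 1.
    by have [e|e|[]//|[e _]] := U _ Ss; move: x1; rewrite e ?bb ?ab.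
  have := cramer2 s ab; have := cramer2 c' ab.
  rewrite c'x y1; move: x1 c'y; set x := det2 s b; set y := det2 a c' => x1 y1' c'E sE.
  have k0 : 0 < x * y - 1 by nia.
  have i0 : 0 <= y - 1 by lia.
  have j0 : 0 <= x - 1 by lia.
  have abn0 : (a.1 + b.1, a.2 + b.2) != (0, 0).
    apply/eqP => -[u1 u2].
    have : det2 a (a.1 + b.1, a.2 + b.2) = 1 by rewrite -ab /det2 /=; ring.
    by rewrite u1 u2 /det2 /= !mulr0 subr0.
  have [||h _] := SK (x * y - 1) (y - 1) (x - 1) 0 _ _ _ _ k0 i0 j0 isT abn0 Ss Sc' Sa.
  - by rewrite [in RHS]sE [in RHS]c'E /=; ring.
  - by rewrite [in RHS]sE [in RHS]c'E /=; ring.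
  by nia.
apply: (@triangle_like_of_max S b a B) => //; first by right.
  move=> s Ss; have [->|->|[x0 y1]|[x1 y0]] := U _ Ss.
  - by right; exists 0; rewrite !mul0r !addr0 -surjective_pairing.
  - by left.
  - right; exists 1; split => //; have x1 : det2 s b = 1 by have := allx _ Ss; lia.
    by rewrite {1}(cramer2 s ab) y1 x1; congr pair; ring.
  - right; exists (det2 a s); split; first exact: ltW.
    by rewrite {1}(cramer2 s ab) x1; congr pair; ring.
exists (det2 a c); split => //.
have x1 : det2 c b = 1 by have := allx _ Sc; lia.
have := cramer2 c ab; rewrite x1 => cE.
by rewrite (_ : (_, _) = c) // {3}cE; congr pair; ring.
Qed.

(** * Support functions and their minimum *)

Section SupportFunctions.
Variables (R : realType) (Phi : set (R * R)).
Hypothesis Phi_compact : @compact (R * R)%type Phi.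

Definition supp_fun (l : int * int) (x : R * R) : R :=
  lam_app l x - supp_val Phi l.

Definition norm1 (l : int * int) : R := `|l.1%:~R| + `|l.2%:~R|.

Lemma supp_fun_shift l (x y : R * R) :
  supp_fun l y = supp_fun l x + lam_app l (y.1 - x.1, y.2 - x.2).
Proof. by rewrite /supp_fun /lam_app /=; ring. Qed.

Lemma lam_app_le_norm1 l (z : R * R) (e : R) :
  `|z.1| <= e -> `|z.2| <= e -> `|lam_app l z| <= e * norm1 l.
Proof.
move=> z1 z2; rewrite /lam_app /norm1 mulrDr.
apply: le_trans (ler_normD _ _) _; rewrite !normrM ![e * _]mulrC.
by apply: lerD; apply: ler_wpM2l.
Qed.

Lemma interior_boxP (p : R * R) :
  @interior (R * R)%type Phi p <-> exists r : R, 0 < r /\ box p r `<=` Phi.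
Proof.
split=> [/nbhs_ballP[r /= r0 H]|[r [r0 H]]].
  by exists r; split => // y [y1 y2]; apply: H; split; rewrite /ball /= distrC.
by apply/nbhs_ballP; exists r => // y [y1 y2]; apply: H; split; rewrite distrC.
Qed.

(** Compactness supplies the lower bound that makes [inf] a genuine infimum and not a default
    value. *)
Lemma supp_val_le l (q : R * R) : Phi q -> supp_val Phi l <= lam_app l q.
Proof.
move=> Phiq; apply: ge_inf; last by exists q.
have [M [_ H]] := compact_bounded Phi_compact.
have MM : M < `|M| + 1 by rewrite ltr_pwDr // ler_norm.
exists (- ((`|M| + 1) * norm1 l)) => _ [x Phix <-].
have := H _ MM x Phix; rewrite /= prod_normE ge_max => /andP[x1 x2].
by have := lam_app_le_norm1 l x1 x2; rewrite ler_norml => /andP[].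
Qed.

Lemma supp_fun_ge0 l (q : R * R) : Phi q -> 0 <= supp_fun l q.
Proof. by move=> /supp_val_le; rewrite subr_ge0. Qed.

Lemma tdist_le l (x : R * R) : Phi x -> l != (0, 0) -> tdist Phi x <= supp_fun l x.
Proof.
move=> Phix l0; apply: ge_inf; last by exists l.
by exists 0 => _ [m _ <-]; exact: supp_fun_ge0.
Qed.

Lemma attainsP (x : R * R) l : Phi x ->
  attains Phi x l <->
  l != (0, 0) /\ forall m, m != (0, 0) -> supp_fun l x <= supp_fun m x.
Proof.
move=> Phix; split=> -[l0 H]; split => //.
  by move=> m m0; rewrite [supp_fun l x]H; exact: tdist_le.
apply/eqP; rewrite eq_le tdist_le // andbT.
by apply: lb_le_inf => [|_ [m m0 <-]]; [exists (supp_fun l x), l|exact: H].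
Qed.

(** The support value is tested at the point reached from [p] by moving [r / 2] against the sign of
    each coordinate of [l]. Consequently only finitely many covectors stay below a given value at
    [p]. *)
Lemma supp_fun_coercive (p : R * R) (r : R) l : 0 < r -> box p r `<=` Phi ->
  r / 2 * norm1 l <= supp_fun l p.
Proof.
move=> r0 H.
pose q := (p.1 - r / 2 * Num.sg l.1%:~R, p.2 - r / 2 * Num.sg l.2%:~R).
have sgr (z : int) : `|r / 2 * Num.sg (z%:~R : R)| < r.
  rewrite normrM normr_sg gtr0_norm; last by lra.
  by case: (_ != 0); rewrite /= ?mulr1 ?mulr0; lra.
have /supp_val_le : Phi q.
  by apply: H; split; rewrite /= addrAC subrr sub0r normrN; exact: sgr.
move=> /(_ l); rewrite /supp_fun /lam_app /norm1 /= !normrEsg.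
set A : R := l.1%:~R; set B : R := l.2%:~R.
rewrite -subr_ge0 => h; rewrite -subr_ge0; apply: le_trans h _.
by rewrite le_eqVlt; apply/orP; left; apply/eqP; ring.
Qed.

(** The minimum over [Phi] of a nonnegative combination is at least the combination of the minima.
    This is subadditivity and positive homogeneity in the integral form that [norm_minimal] asks
    for. *)
Lemma supp_fun_comb (x : R * R) (k i j h : int) (u l m s : int * int) :
  Phi x -> 0 < k -> 0 <= i -> 0 <= j -> 0 <= h ->
  k * u.1 = i * l.1 + j * m.1 + h * s.1 ->
  k * u.2 = i * l.2 + j * m.2 + h * s.2 ->
  k%:~R * supp_fun u x <=
    i%:~R * supp_fun l x + j%:~R * supp_fun m x + h%:~R * supp_fun s x.
Proof.
move=> Phix k0 i0 j0 h0 /(congr1 (fun z : int => z%:~R : R)) e1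
  /(congr1 (fun z : int => z%:~R : R)) e2.
have kR : 0 < (k%:~R : R) by rewrite ltr0z.
have iR : 0 <= (i%:~R : R) by rewrite ler0z.
have jR : 0 <= (j%:~R : R) by rewrite ler0z.
have hR : 0 <= (h%:~R : R) by rewrite ler0z.
rewrite !(intrD, intrM) in e1 e2.
have lamE (q : R * R) : k%:~R * lam_app u q =
    i%:~R * lam_app l q + j%:~R * lam_app m q + h%:~R * lam_app s q.
  by rewrite /lam_app mulrDr !mulrA e1 e2; ring.
rewrite /supp_fun mulrBr lamE !mulrBr.
suff : (i%:~R * supp_val Phi l + j%:~R * supp_val Phi m + h%:~R * supp_val Phi s)
    / k%:~R <= supp_val Phi u.
  by rewrite ler_pdivrMr // [supp_val _ u * _]mulrC; lra.
apply: lb_le_inf; first by exists (lam_app u x), x.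
move=> _ [q Phiq <-]; rewrite ler_pdivrMr // [lam_app _ _ * _]mulrC lamE.
by rewrite !lerD // ler_wpM2l // supp_val_le.
Qed.

(** All of [l], [m], [s] have the value [t = tdist Phi p], and [u] has at least that; the inequality
    [k t <= (i + j + h) t] is then divided by [t > 0]. *)
Lemma attains_norm_minimal (p : R * R) :
  Phi p -> 0 < tdist Phi p -> norm_minimal (attains Phi p).
Proof.
move=> Phip t0 k i j h u l m s k0 i0 j0 h0 u0 [_ El] [_ Em] [_ Es] e1 e2.
have := supp_fun_comb Phip k0 i0 j0 h0 e1 e2.
rewrite /supp_fun El Em Es -/(supp_fun u p) -!mulrDl -!intrD => le1.
have kR : 0 < (k%:~R : R) by rewrite ltr0z.
have le2 := tdist_le Phip u0.
split.
  rewrite -(ler_int R) -(ler_pM2r t0); apply: le_trans le1.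
  by rewrite ler_pM2l.
move=> kE; split => //; apply/eqP; rewrite eq_le le2 andbT.
by move: le1; rewrite -kE ler_pM2l.
Qed.

Lemma seq_argmin (T : eqType) (P : T -> Prop) (f : T -> R) (s : seq T) :
  (exists x, x \in s /\ P x) ->
  exists x, P x /\ forall y, y \in s -> P y -> f x <= f y.
Proof.
elim: s => [[x []]//|a s IH] [x [xs Px]].
have [/IH[y [Py ymin]]|nos] := pselect (exists x, x \in s /\ P x); last first.
  have nP z : z \in s -> ~ P z by move=> zs Pz; apply: nos; exists z.
  move: xs; rewrite inE => /orP[/eqP xa|/nP]//.
  exists x; split => // z; rewrite inE => /orP[/eqP ->|/nP]//.
  by rewrite xa.
have [[Pa fay]|noa] := pselect (P a /\ f a <= f y).
  exists a; split => // z; rewrite inE => /orP[/eqP ->//|zs Pz].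
  exact: le_trans fay (ymin _ zs Pz).
exists y; split => // z; rewrite inE => /orP[/eqP ->|]; last exact: ymin.
by move=> Pa; rewrite leNgt; apply/negP => /ltW fay; apply: noa.
Qed.

Lemma int_vectors_bounded (B : R) :
  exists s : seq (int * int), forall l, norm1 l <= B -> l \in s.
Proof.
pose N := Num.truncn B.
pose zs := [seq k%:Z - N%:Z | k <- iota 0 (N + N).+1].
exists [seq (i, j) | i <- zs, j <- zs] => -[i j] lB.
have zsP (z : int) : `|z%:~R : R| <= B -> z \in zs.
  rewrite -intr_norm => zB.
  have zN : (`|z| <= N)%N.
    by rewrite /N truncn_ge_nat ?(le_trans _ zB) // -[_%:R]/((`|z|%N)%:~R) abszE.
  by apply/mapP; exists `|(z + N%:Z)%R|%N; [rewrite mem_iota; lia|lia].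
apply: (@allpairs_f _ _ _ pair); apply: zsP.
  by apply: le_trans lB; rewrite /norm1 lerDl.
by apply: le_trans lB; rewrite /norm1 lerDr.
Qed.

End SupportFunctions.

(** Here [tau s] is the tangent of the angle from [v] to [s], defined throughout the open
    half-plane, and [det2 s s'] has the sign of [tau s' - tau s]. The extremes are where [tau] is
    least and greatest on the finite set [S]. *)
Lemma half_plane_extremes (R : realType) (S : set (int * int)) (v : R * R)
    (l m : int * int) (L : seq (int * int)) :
  norm_minimal S -> (forall s, S s -> s \in L) ->
  (forall s, S s -> 0 < lam_app s v) -> S l -> S m -> l != m ->
  exists a b, [/\ S a, S b, 0 < det2 a b &
    forall s, S s -> 0 <= det2 a s /\ 0 <= det2 s b].
Proof.
move=> SK SL Sv Sl Sm lm.
pose w := (- v.2, v.1); pose tau s := lam_app s w / lam_app s v.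
have Sn0 s : S s -> s != (0, 0).
  by move=> /Sv; apply: contraTneq => ->; rewrite /lam_app /= !mul0r addr0 ltxx.
have v0 : 0 < v.1 ^+ 2 + v.2 ^+ 2.
  have [v1|v1] := eqVneq v.1 0; last by rewrite ltr_pwDl ?sqr_ge0 // exprn_even_gt0.
  have [v2|v2] := eqVneq v.2 0; last by rewrite ltr_wpDl ?sqr_ge0 // exprn_even_gt0.
  by have := Sv _ Sl; rewrite /lam_app v1 v2 !mulr0 addr0 ltxx.
have detE s s' : S s -> S s' -> (det2 s s')%:~R * (v.1 ^+ 2 + v.2 ^+ 2) =
    (tau s' - tau s) * (lam_app s v * lam_app s' v).
  move=> /Sv sv /Sv s'v.
  transitivity (lam_app s v * lam_app s' w - lam_app s w * lam_app s' v).
    by rewrite /det2 /lam_app intrB !intrM /=; ring.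
  by rewrite /tau; field; rewrite !gt_eqF.
have det_ge0 s s' : S s -> S s' -> tau s <= tau s' -> 0 <= det2 s s'.
  move=> Ss Ss' le; rewrite -(ler0z R) -(pmulr_lge0 _ v0) detE //.
  by rewrite mulr_ge0 ?subr_ge0 // mulr_ge0 ?ltW // Sv.
have [|a [Sa amin]] := @seq_argmin R _ S tau L; first by exists l; split => //; exact: SL.
have [|b [Sb bmax]] := @seq_argmin R _ S (fun s => - tau s) L.
  by exists l; split => //; exact: SL.
have ext s : S s -> tau a <= tau s /\ tau s <= tau b.
  move=> Ss; split; first exact: amin (SL _ Ss) Ss.
  by rewrite -lerN2; exact: bmax (SL _ Ss) Ss.
exists a, b; split => //; last first.
  by move=> s Ss; have [? ?] := ext _ Ss; split; exact: det_ge0.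
rewrite lt_neqAle det_ge0 ?andbT //; last by have [] := ext _ Sa.
(* If the extremes were parallel, [tau] would be constant on [S]; then [l] and [m] are parallel, on
   the same side, and neither is a proper multiple of the other, so they coincide. *)
apply: contra lm => /eqP D0.
have tab : tau a = tau b.
  have := detE _ _ Sa Sb; rewrite -D0 mul0r => /esym/eqP.
  by rewrite !mulf_eq0 (gt_eqF (Sv _ Sa)) (gt_eqF (Sv _ Sb)) !orbF subr_eq0 => /eqP.
have tlm : tau l = tau m.
  have [? ?] := ext _ Sl; have [? ?] := ext _ Sm.
  by apply/eqP; rewrite eq_le; apply/andP; split; lra.
have dlm : det2 l m = 0.
  have := detE _ _ Sl Sm; rewrite tlm subrr mul0r => /eqP.
  by rewrite mulf_eq0 (gt_eqF v0) orbF intr_eq0 => /eqP.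
have [u lu] := norm_minimal_primitive SK Sl (Sn0 _ Sl).
have := cramer2 m lu; rewrite dlm !mul0r !addr0; set z := det2 m u => mE.
have z0 : 0 < z.
  rewrite -(ltr0z R) -(pmulr_lgt0 _ (Sv _ Sl)).
  rewrite (_ : _ * _ = lam_app m v); first exact: Sv.
  by rewrite mE /lam_app /= !intrM; ring.
suff z1 : z = 1 by apply/eqP; rewrite mE z1 !mul1r -surjective_pairing.
by apply: (norm_minimal_parallel SK (Sn0 _ Sl) _ z0); rewrite -mE.
Qed.

Lemma box_le (R : realType) (p : R * R) (e e' : R) : e <= e' -> box p e `<=` box p e'.
Proof. by move=> ee' y [y1 y2]; split; [apply: lt_le_trans y1 _|apply: lt_le_trans y2 _]. Qed.

Lemma box_box (R : realType) (p x : R * R) (e : R) : box p e x ->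
  exists e' : R, 0 < e' /\ box x e' `<=` box p e.
Proof.
move=> [x1 x2]; exists (Num.min (e - `|x.1 - p.1|) (e - `|x.2 - p.2|)); split.
  by rewrite lt_min !subr_gt0 x1.
move=> y []; rewrite !lt_min => /andP[y1 _] /andP[_ y2]; split.
  have -> : y.1 - p.1 = (y.1 - x.1) + (x.1 - p.1) by ring.
  by apply: le_lt_trans (ler_normD _ _) _; lra.
have -> : y.2 - p.2 = (y.2 - x.2) + (x.2 - p.2) by ring.
by apply: le_lt_trans (ler_normD _ _) _; lra.
Qed.

(** * The distance series near an interior point *)

Section LocalStructure.
Variables (R : realType) (Phi : set (R * R)) (p : R * R).
Hypothesis Phi_compact : @compact (R * R)%type Phi.
Hypothesis p_interior : @interior (R * R)%type Phi p.

Definition incr (l : int * int) (y : R * R) : R :=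
  lam_app l (y.1 - p.1, y.2 - p.2).

Lemma attains_bounded : exists B : R, forall l, attains Phi p l -> norm1 R l <= B.
Proof.
have [r [r0 rPhi]] := (interior_boxP _ _).1 p_interior.
exists (tdist Phi p / (r / 2)) => l [_ lE].
have r20 : 0 < r / 2 by lra.
rewrite ler_pdivlMr // mulrC -lE.
exact: (supp_fun_coercive Phi_compact).
Qed.

(** Covectors that do not attain the minimum at [p] exceed it by a uniform gap if short, and by
    coercivity if long; in a small box neither kind catches up with the attaining [f]. *)
Lemma attains_near : (exists l, attains Phi p l) ->
  exists e : R, 0 < e /\ forall y, box p e y ->
    [/\ @interior (R * R)%type Phi y,
      forall m, attains Phi y m <-> attains Phi p m /\
        forall m', attains Phi p m' -> incr m y <= incr m' y &
      forall m, attains Phi y m -> tdist Phi y = tdist Phi p + incr m y].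
Proof.
move=> [f Sf].
have [r [r0 rPhi]] := (interior_boxP _ _).1 p_interior.
have Phip : Phi p by apply: rPhi; split; rewrite subrr normr0.
set t := tdist Phi p.
have t0 : 0 <= t by rewrite /t; have [_ <-] := Sf; exact: supp_fun_ge0.
(* Beyond norm [B], a quarter of [r] times the norm already exceeds [t + 1]; the second summand
   makes [f] itself count as short. *)
pose B := 4 / r * (t + 1) + norm1 R f.
have n1ge0 l : 0 <= norm1 R l by rewrite /norm1 addr_ge0.
have B0 : 0 <= B by rewrite addr_ge0 // mulr_ge0 // ?divr_ge0 ?ltW //; lra.
have [L LP] := int_vectors_bounded B.
(* the vectors close to the minimum are finitely many, hence a gap above t *)
have [g [g0 gap]] : exists g : R, 0 < g /\
    forall l, norm1 R l <= B -> t < supp_fun Phi l p -> t + g <= supp_fun Phi l p.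
  have [ex|nex] := pselect (exists l, l \in L /\ t < supp_fun Phi l p).
    have [m [mt mmin]] := @seq_argmin R _ (fun l => t < supp_fun Phi l p)
      (fun l => supp_fun Phi l p) L ex.
    exists (supp_fun Phi m p - t); rewrite subr_gt0; split => // l /LP lL lt.
    by rewrite subrKC; exact: mmin.
  by exists 1; split => // l /LP lL lt; exfalso; apply: nex; exists l.
(* The first bound keeps the box in [Phi] and costs at most half of the coercivity, the second keeps
   variations of short covectors below the gap [g], the third keeps the variation of [f] below 1. *)
pose e := Num.min (r / 4) (Num.min (g / 4 / (B + 1)) (1 / (B + 1))).
have B1 : 0 < B + 1 by lra.
have e0 : 0 < e by rewrite !lt_min !divr_gt0.
have er : e <= r / 4 by rewrite ge_min lexx.
have eg : e * (B + 1) <= g / 4 by rewrite -ler_pdivlMr // !ge_min lexx orbT.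
have e1 : e * (B + 1) <= 1 by rewrite -ler_pdivlMr // !ge_min lexx !orbT.
have yPhi y : box p e y -> Phi y.
  by move=> ye; apply: rPhi; apply: box_le ye; lra.
have incr_le l y : box p e y -> `|incr l y| <= e * norm1 R l.
  by move=> [y1 y2]; apply: lam_app_le_norm1 => /=; exact: ltW.
have suppE l y : attains Phi p l -> supp_fun Phi l y = t + incr l y.
  by move=> [_ lE]; rewrite (supp_fun_shift _ _ p) [supp_fun Phi l p]lE.
have far l y : box p e y -> l != (0, 0) -> ~ attains Phi p l ->
    supp_fun Phi f y < supp_fun Phi l y.
  move=> ye l0 nSl; rewrite suppE // (supp_fun_shift _ l p) -/(incr l y).
  have := incr_le f y ye; have := incr_le l y ye.
  rewrite !ler_norml => /andP[hl _] /andP[_ hf].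
  have fB : norm1 R f <= B by rewrite lerDr mulr_ge0 // ?divr_ge0 ?ltW //; lra.
  have efB : e * norm1 R f <= e * B by rewrite ler_pM2l.
  have lt : t < supp_fun Phi l p.
    rewrite lt_neqAle (tdist_le Phi_compact) // andbT.
    by apply/eqP => tE; apply: nSl; split.
  have [lB|lB] := leP (norm1 R l) B.
    have elB : e * norm1 R l <= e * B by rewrite ler_pM2l.
    by have := gap l lB lt; lra.
  have := supp_fun_coercive Phi_compact l r0 rPhi.
  have el : e * norm1 R l <= r / 4 * norm1 R l by rewrite ler_wpM2r.
  have : 4 / r * (t + 1) < norm1 R l.
    by apply: le_lt_trans lB; rewrite lerDl.
  rewrite mulrAC ltr_pdivrMr // [norm1 R l * r]mulrC => h4.
  by lra.
exists e; split => // y ye; split.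
- by apply/interior_boxP; have [e' [e'0 e'e]] := box_box ye;
    exists e'; split => // z /e'e; exact: yPhi.
- move=> m; split.
    move=> /(attainsP Phi_compact _ (yPhi _ ye))[m0 mmin].
    have Sm : attains Phi p m.
      apply: contrapT => nSm; have := far _ _ ye m0 nSm.
      by rewrite ltNge mmin //; case: Sf.
    split => // m' Sm'; have := mmin m' Sm'.1.
    by rewrite !suppE // lerD2l.
  move=> [Sm mmin]; apply/(attainsP Phi_compact _ (yPhi _ ye)); split; first exact: Sm.1.
  move=> m' m'0; have [Sm'|nSm'] := pselect (attains Phi p m').
    by rewrite !suppE // lerD2l; exact: mmin.
  by apply: le_trans (ltW (far _ _ ye m'0 nSm')); rewrite !suppE // lerD2l; exact: mmin.
move=> m ym; have [_ <-] := ym; apply: suppE.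
have [m0 mmin] := (attainsP Phi_compact m (yPhi _ ye)).1 ym.
apply: contrapT => nSm; have := far _ _ ye m0 nSm.
by rewrite ltNge mmin //; case: Sf.
Qed.

(** Near [p] the competing values are [incr l y + i * incr f y]: two of them agree exactly when
    [incr f y = 0], and then all do. The caustic is thus the line through [p] on which [f] is
    constant. *)
Lemma segment_like_not_vertex :
  segment_like (attains Phi p) -> ~ is_vertex (caustic Phi) p.
Proof.
move=> [l [f [D [f0 D0 Sl SlD Sall]]]] [_]; apply.
have [|e [e0 loc]] := attains_near; first by exists l.
exists e; split => //.
have f0' : (- f.2%:~R, f.1%:~R) != (0, 0) :> R * R.
  apply: contra f0 => /eqP[/eqP f2 /eqP f1]; move: f1 f2.
  by rewrite oppr_eq0 !intr_eq0 => /eqP f1 /eqP f2; rewrite [f]surjective_pairing f1 f2.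
exists (- f.2%:~R, f.1%:~R); split => //.
have incrE (i : int) y : incr (l.1 + i * f.1, l.2 + i * f.2) y =
    incr l y + i%:~R * incr f y.
  by rewrite /incr /lam_app /= !intrD !intrM; ring.
apply/seteqP; split => y [yK ye]; split => //.
  have [yint att _] := loc _ ye; case: yK => _ [m [m' [mm' [/att[Sm mmin] /att[Sm' m'min]]]]].
  have [i [_ mE]] := Sall _ Sm; have [j [_ m'E]] := Sall _ Sm'.
  have ij : i != j by apply: contra mm' => /eqP ij; rewrite mE m'E ij.
  have : incr m y = incr m' y by apply/eqP; rewrite eq_le mmin // m'min.
  rewrite mE m'E !incrE => /addrI/eqP; rewrite -subr_eq0 -mulrBl mulf_eq0.
  rewrite -intrB intr_eq0 subr_eq0 (negbTE ij) /= => /eqP.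
  rewrite /incr /lam_app /= => f_y.
  have n0 : (f.1%:~R : R) ^+ 2 + f.2%:~R ^+ 2 != 0.
    rewrite paddr_eq0 ?sqr_ge0 // !sqrf_eq0.
    by apply: contra f0' => /andP[/eqP -> /eqP ->]; rewrite oppr0.
  (* This is the coefficient of the orthogonal projection of [y - p] on [(- f.2, f.1)]. *)
  exists ((f.1%:~R * (y.2 - p.2) - f.2%:~R * (y.1 - p.1)) / (f.1%:~R ^+ 2 + f.2%:~R ^+ 2)).
  move: n0 f_y; set A : R := f.1%:~R; set C : R := f.2%:~R => n0 /eqP.
  rewrite addr_eq0 => /eqP f_y.
  rewrite [LHS]surjective_pairing /move_pt /=; congr pair;
    rewrite addrC; apply/eqP; rewrite -subr_eq; apply/eqP.
    move: f_y; set z1 := y.1 - p.1; set z2 := y.2 - p.2 => f_y.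
    apply: (mulIf n0); transitivity (A * (A * z1) + C ^+ 2 * z1); first by ring.
    by rewrite f_y; field.
  move: f_y; set z1 := y.1 - p.1; set z2 := y.2 - p.2 => f_y.
  apply: (mulIf n0); transitivity (A ^+ 2 * z2 - C * (- (C * z2))); first by ring.
  by rewrite -f_y; field.
move: yK => [s yE].
have f_y : incr f y = 0 by rewrite yE /incr /lam_app /=; ring.
have att m : attains Phi p m -> attains Phi y m.
  have [_ att _] := loc _ ye => Sm; apply/att; split => // m' Sm'.
  have [i [_ ->]] := Sall _ Sm; have [j [_ ->]] := Sall _ Sm'.
  by rewrite !incrE f_y !mulr0.
split; first by have [] := loc _ ye.
exists l, (l.1 + D * f.1, l.2 + D * f.2); split; last by split; exact: att.
apply: contra f0 => /eqP; rewrite {1}[l]surjective_pairing => -[e1 e2].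
have : D * f.1 = 0 by lia.
have : D * f.2 = 0 by lia.
move=> /eqP; rewrite mulf_eq0 (gt_eqF D0) /= => /eqP f2 /eqP.
by rewrite mulf_eq0 (gt_eqF D0) /= => /eqP f1; rewrite [f]surjective_pairing f1 f2.
Qed.

End LocalStructure.

(** * The trivalent vertex *)

Lemma lattice_length_unimodular (u v : int * int) :
  det2 u v = 1 \/ det2 u v = -1 -> lattice_length u = 1%N.
Proof.
move=> uv; apply/eqP; rewrite -dvdn1 /lattice_length.
set g := gcdn _ _.
have g1 : (g%:Z %| u.1)%Z by rewrite dvdzE dvdn_gcdl.
have g2 : (g%:Z %| u.2)%Z by rewrite dvdzE dvdn_gcdr.
have : (g%:Z %| det2 u v)%Z by rewrite /det2 rpredB // dvdz_mulr.
by case: uv => ->.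
Qed.

Lemma lattice_length_scale (n : nat) (u : int * int) :
  lattice_length (n%:Z * u.1, n%:Z * u.2) = (n * lattice_length u)%N.
Proof. by rewrite /lattice_length /= !abszM /= muln_gcdr. Qed.

Lemma lattice_length_vsubC (l m : int * int) :
  lattice_length (vsub l m) = lattice_length (vsub m l).
Proof. by rewrite /lattice_length /vsub /= -(opprB m.1 l.1) -(opprB m.2 l.2) !abszN. Qed.

(** Near [x] the series is the minimum of two affine functions whose difference is [kappa] times the
    cross product with [d]. The sign of [kappa] tells which gradient is on which side, and lattice
    length ignores the order. *)
Lemma edge_weight_two_forms (R : realType) (Phi : set (R * R)) (p x d : R * R)
    (l m : int * int) (t e kappa : R) :
  0 < e -> kappa != 0 ->
  (forall z : R * R, lam_app l z - lam_app m z = kappa * cross d z) ->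
  incr p l x = incr p m x ->
  (forall y, box x e y -> incr p l y <= incr p m y -> tdist Phi y = t + incr p l y) ->
  (forall y, box x e y -> incr p m y <= incr p l y -> tdist Phi y = t + incr p m y) ->
  edge_weight Phi x d (lattice_length (vsub l m)).
Proof.
move=> e0 k0 lmE lmx tl tm.
have incrB y : incr p l y - incr p m y = kappa * cross d (y.1 - x.1, y.2 - x.2).
  rewrite -lmE; apply/eqP; rewrite -subr_eq0; apply/eqP.
  transitivity (incr p l x - incr p m x); last by rewrite lmx subrr.
  by rewrite /incr /lam_app /=; ring.
have gl U : (forall y, U y -> box x e y /\ incr p l y <= incr p m y) ->
    gradient_on Phi U l.
  move=> H; exists (lam_app l p - t) => y /H[ye lem]; rewrite tl //.
  by rewrite /incr /lam_app /=; ring.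
have gm U : (forall y, U y -> box x e y /\ incr p m y <= incr p l y) ->
    gradient_on Phi U m.
  move=> H; exists (lam_app m p - t) => y /H[ye lem]; rewrite tm //.
  by rewrite /incr /lam_app /=; ring.
case: (ltgtP kappa 0) k0 => // k0 _.
  exists l, m, e; split => //; split; [|split => //].
    apply: gl => y [ye] /= c0; split => //.
    by rewrite -subr_le0 incrB nmulr_rle0 // ltW.
  apply: gm => y [ye] /= c0; split => //.
  by rewrite -subr_ge0 incrB nmulr_rge0 // ltW.
exists m, l, e; split => //; split; [|split; last exact: lattice_length_vsubC].
  apply: gm => y [ye] /= c0; split => //.
  by rewrite -subr_ge0 incrB pmulr_rge0 // ltW.
apply: gl => y [ye] /= c0; split => //.
by rewrite -subr_le0 incrB pmulr_rle0 // ltW.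
Qed.

Lemma incr_pos_near (R : realType) (p x : R * R) (u : int * int) : 0 < incr p u x ->
  exists e : R, 0 < e /\ forall y, box x e y -> 0 < incr p u y.
Proof.
move=> u0; have n0 : 0 < norm1 R u + 1 by rewrite ltr_wpDl // addr_ge0.
exists (incr p u x / (norm1 R u + 1)); split; first exact: divr_gt0.
set e := _ / _ => y [y1 y2].
have e0 : 0 < e by exact: divr_gt0.
have := @lam_app_le_norm1 R u (y.1 - x.1, y.2 - x.2) e (ltW y1) (ltW y2).
rewrite ler_norml => /andP[h _].
have -> : incr p u y = incr p u x + lam_app u (y.1 - x.1, y.2 - x.2).
  by rewrite /incr /lam_app /=; ring.
have eE : e * (norm1 R u + 1) = incr p u x by rewrite /e mulfVK // gt_eqF.
lra.
Qed.

Section Triangle.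
Variables (R : realType) (Phi : set (R * R)) (p : R * R) (a b : int * int) (n : nat).
Hypothesis ab : det2 a b = 1 \/ det2 a b = -1.
Hypothesis n_gt0 : (0 < n)%N.

Let c := (b.1 + n%:Z * a.1, b.2 + n%:Z * a.2).
Let X := incr p a.
Let Y := incr p b.
Let dlt : R := (det2 a b)%:~R.

(* The dual basis of (a, b) is (e1 + e2, - e2). *)
Definition tri_e1 : int * int :=
  (det2 a b * (b.2 - a.2), det2 a b * (a.1 - b.1)).
Definition tri_e2 : int * int := (det2 a b * a.2, - (det2 a b * a.1)).

Let d1 := lat R tri_e2.
Let d2 := lat R ((- tri_e1.1 - n%:Z * tri_e2.1)%R, (- tri_e1.2 - n%:Z * tri_e2.2)%R).
Let d3 := lat R tri_e1.

Lemma tri_det : det2 tri_e1 tri_e2 = 1 \/ det2 tri_e1 tri_e2 = -1.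
Proof.
have -> : det2 tri_e1 tri_e2 = - (det2 a b) ^+ 3.
  by rewrite {1}/det2 /= /det2; ring.
by case: ab => ->; [right|left].
Qed.

Let dlt2 : dlt * dlt = 1.
Proof. by rewrite /dlt; case: ab => ->; ring. Qed.

Let dltE : dlt * (a.1%:~R * b.2%:~R - a.2%:~R * b.1%:~R) = 1.
Proof. by rewrite -[RHS]dlt2 {3}/dlt /det2 intrB !intrM. Qed.

Let dlt_neq0 : dlt != 0.
Proof. by apply/eqP => d0; move: dlt2; rewrite d0 mul0r => /eqP; rewrite eq_sym oner_eq0. Qed.

Let d1E : d1 = (dlt * a.2%:~R, - (dlt * a.1%:~R)).
Proof. by rewrite /d1 /lat /= intrN !intrM. Qed.

Let d3E : d3 = (dlt * (b.2%:~R - a.2%:~R), dlt * (a.1%:~R - b.1%:~R)).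
Proof. by rewrite /d3 /lat /= !intrM -/dlt !intrB. Qed.

Let d2E : d2 = (- d3.1 - n%:R * d1.1, - d3.2 - n%:R * d1.2).
Proof. by congr pair; rewrite intrB intrN intrM. Qed.

Let incr_c y : incr p c y = Y y + n%:R * X y.
Proof. by rewrite /Y /X /incr /lam_app /= !intrD !intrM; ring. Qed.

(** In the coordinates [(X, Y)] the three rays have directions [(0, -1)], [(-1, n - 1)] and
    [(1, 1)]. These are the loci where the minimum of [X], [Y], [Y + n X] is shared by [b] and [c],
    by [a] and [c], and by [a] and [b]. *)
Let XY_d1 s : X (move_pt p d1 s) = 0 /\ Y (move_pt p d1 s) = - s.
Proof.
rewrite d1E /X /Y /incr /lam_app /=; split; first by ring.
transitivity (- s * (dlt * (a.1%:~R * b.2%:~R - a.2%:~R * b.1%:~R))); last by rewrite dltE mulr1.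
by ring.
Qed.

Let XY_d3 s : X (move_pt p d3 s) = s /\ Y (move_pt p d3 s) = s.
Proof.
rewrite d3E /X /Y /incr /lam_app /=; split;
  (transitivity (s * (dlt * (a.1%:~R * b.2%:~R - a.2%:~R * b.1%:~R)));
    last by rewrite dltE mulr1);
  by ring.
Qed.

Let XY_d2 s : X (move_pt p d2 s) = - s /\ Y (move_pt p d2 s) = (n%:R - 1) * s.
Proof.
have [X1 Y1] := XY_d1 s; have [X3 Y3] := XY_d3 s.
have dE u : incr p u (move_pt p d2 s) =
    - incr p u (move_pt p d3 s) - n%:R * incr p u (move_pt p d1 s).
  by rewrite d2E /incr /lam_app /=; ring.
rewrite /X /Y !dE -/(X _) -/(Y _) -/(X _) -/(Y _) X1 X3 Y1 Y3; split; ring.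
Qed.

Let dual_basis y : y = move_pt (move_pt p d3 (X y)) d1 (X y - Y y).
Proof.
rewrite [LHS]surjective_pairing d1E d3E /move_pt /=.
congr pair; rewrite -addrA addrC; apply/eqP; rewrite -subr_eq; apply/eqP.
  transitivity ((y.1 - p.1) * (dlt * (a.1%:~R * b.2%:~R - a.2%:~R * b.1%:~R))).
    by rewrite dltE mulr1.
  by rewrite /X /Y /incr /lam_app /=; ring.
transitivity ((y.2 - p.2) * (dlt * (a.1%:~R * b.2%:~R - a.2%:~R * b.1%:~R))).
  by rewrite dltE mulr1.
by rewrite /X /Y /incr /lam_app /=; ring.
Qed.

Hypothesis Sa : attains Phi p a.
Hypothesis Sb : attains Phi p b.
Hypothesis Sc : attains Phi p c.
Hypothesis Sall : forall s, attains Phi p s -> s = a \/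
  exists i : int, 0 <= i <= n%:Z /\ s = (b.1 + i * a.1, b.2 + i * a.2).

Variable e : R.
Hypothesis e_gt0 : 0 < e.
Hypothesis loc : forall y, box p e y ->
    [/\ @interior (R * R)%type Phi y,
      forall m, attains Phi y m <-> attains Phi p m /\
        forall m', attains Phi p m' -> incr p m y <= incr p m' y &
      forall m, attains Phi y m -> tdist Phi y = tdist Phi p + incr p m y].

Let nR : 0 < n%:R :> R. Proof. by rewrite ltr0n. Qed.

Let incr_i (i : int) y : incr p (b.1 + i * a.1, b.2 + i * a.2) y = Y y + i%:~R * X y.
Proof. by rewrite /Y /X /incr /lam_app /= !intrD !intrM; ring. Qed.

(** Comparison with the corners suffices because [Y + i X] lies between [Y] and [Y + n X]: the
    former bounds it below if [X >= 0], the latter if [X <= 0]. *)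
Lemma tri_attains y m : box p e y -> attains Phi p m ->
  incr p m y <= X y -> incr p m y <= Y y -> incr p m y <= incr p c y ->
  attains Phi y m.
Proof.
move=> ye Sm mX mY mc; have [_ att _] := loc ye; apply/att; split => // m' Sm'.
have [->//|[i [/andP[i0 iN] ->]]] := Sall Sm'.
rewrite incr_i; rewrite incr_c in mc.
have i0R : 0 <= i%:~R :> R by rewrite ler0z.
have iNR : i%:~R <= n%:R :> R by rewrite -[n%:R]/(n%:Z%:~R) ler_int.
have [X0|X0] := leP 0 (X y).
  by apply: le_trans mY _; rewrite lerDl mulr_ge0.
by apply: le_trans mc _; rewrite lerD2l ler_wnM2r // ltW.
Qed.

Lemma tri_attains_a y : box p e y -> X y <= Y y -> X y <= Y y + n%:R * X y ->
  attains Phi y a.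
Proof. by move=> ye ? ?; apply: tri_attains; rewrite // incr_c. Qed.

Lemma tri_attains_b y : box p e y -> Y y <= X y -> 0 <= X y -> attains Phi y b.
Proof.
by move=> ye ? ?; apply: tri_attains; rewrite // incr_c lerDl mulr_ge0.
Qed.

Lemma tri_attains_c y : box p e y -> Y y + n%:R * X y <= X y -> X y <= 0 ->
  attains Phi y c.
Proof.
move=> ye ? ?; apply: tri_attains; rewrite // incr_c //.
by rewrite gerDl pmulr_rle0.
Qed.

Let tdistE y m : box p e y -> attains Phi y m -> tdist Phi y = tdist Phi p + incr p m y.
Proof. by move=> /loc[_ _]; exact. Qed.

Let a_neq0 : a != (0, 0). Proof. exact: Sa.1. Qed.

Let a_neq_i (i : int) : a != (b.1 + i * a.1, b.2 + i * a.2).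
Proof.
apply/eqP => aE; have : det2 a a = det2 a b.
  by rewrite {2}aE /det2 /=; ring.
rewrite {1}/det2 mulrC subrr => ab0.
by case: ab; rewrite -ab0.
Qed.

Let b_neq_c : b != c.
Proof.
apply/eqP; rewrite [b]surjective_pairing /c => -[b1 b2].
have n0 : n%:Z != 0 by lia.
have a1 : a.1 = 0 by apply: (mulfI n0); lia.
have a2 : a.2 = 0 by apply: (mulfI n0); lia.
by move: a_neq0; rewrite [a]surjective_pairing a1 a2 eqxx.
Qed.

Lemma tri_caustic y : box p e y ->
  caustic Phi y <-> (ray p d1 `|` ray p d2 `|` ray p d3) y.
Proof.
move=> ye; have [yint att _] := loc ye.
split; last first.
  move=> yray; split => //; move: yray => [[|]|] [s [s0 yE]].
  - have := XY_d1 s; rewrite -yE => -[X0 Y0].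
    exists b, c; split => //; split.
      by apply: tri_attains_b; rewrite // X0 ?Y0 ?oppr_le0.
    by apply: tri_attains_c; rewrite // X0 ?Y0 ?mulr0 ?addr0 ?oppr_le0.
  - have := XY_d2 s; rewrite -yE => -[X0 Y0].
    have ns : 0 <= n%:R * s by rewrite mulr_ge0 // ltW.
    exists a, c; split; [exact: a_neq_i|split].
      by apply: tri_attains_a; rewrite // X0 ?Y0; lra.
    by apply: tri_attains_c; rewrite // X0 ?Y0; lra.
  - have := XY_d3 s; rewrite -yE => -[X0 Y0].
    exists a, b; split.
      by have := a_neq_i 0; rewrite !mul0r !addr0 -surjective_pairing.
    split; last by apply: tri_attains_b; rewrite // X0 ?Y0.
    by apply: tri_attains_a; rewrite // X0 ?Y0 // lerDl mulr_ge0.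
(* A tie [X = Y + i X] with [X >= 0] gives [Y <= X], and comparison with [b] gives equality: the
   third ray. With [X < 0], comparison with [c] forces [n X = i X]: the second ray. *)
have mixed (i : int) : 0 <= i <= n%:Z -> attains Phi y a ->
    attains Phi y (b.1 + i * a.1, b.2 + i * a.2) ->
    (ray p d1 `|` ray p d2 `|` ray p d3) y.
  move=> /andP[i0 iN] /att[_ amin] /att[Si imin].
  have XE : X y = Y y + i%:~R * X y.
    by apply/eqP; rewrite eq_le -{2}incr_i imin // andbT -incr_i amin.
  have XY := amin _ Sb; have Xc := amin _ Sc; rewrite incr_c in Xc.
  rewrite -/(X y) -/(Y y) in XY Xc.
  have i0R : 0 <= i%:~R :> R by rewrite ler0z.
  have iNR : i%:~R <= n%:R :> R by rewrite -[n%:R]/(n%:Z%:~R) ler_int.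
  have [X0|X0] := leP 0 (X y).
    right; exists (X y); split => //.
    have iX : 0 <= i%:~R * X y by rewrite mulr_ge0.
    have YX : Y y = X y by lra.
    by rewrite {1}(dual_basis y) YX subrr /move_pt /= !mul0r !addr0.
  left; right; exists (- X y); split; first by lra.
  have niX : 0 <= (n%:R - i%:~R) * X y by rewrite mulrBl; lra.
  have nX : n%:R * X y = i%:~R * X y.
    have : (n%:R - i%:~R) * X y <= 0 by rewrite mulr_ge0_le0 ?subr_ge0 // ltW.
    by rewrite mulrBl in niX *; lra.
  have YX : Y y = X y - n%:R * X y by lra.
  by rewrite {1}(dual_basis y) YX d2E /move_pt /=; congr pair; ring.
move=> [_ [m [m' [mm' [ym ym']]]]].
have [Sm mmin] := (att m).1 ym; have [Sm' m'min] := (att m').1 ym'.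
have [mE|[i [iN mE]]] := Sall Sm; have [m'E|[j [jN m'E]]] := Sall Sm'.
- by move: mm'; rewrite mE m'E eqxx.
- by move: ym ym'; rewrite mE m'E; exact: mixed.
- by move: ym ym'; rewrite mE m'E => yi ya; exact: mixed yi.
(* Two distinct points of the long edge tie only where [X = 0], and comparison with [a] gives
   [Y <= 0]: the first ray. *)
have ij : i != j by apply: contra mm' => /eqP ij; rewrite mE m'E ij.
have : incr p m y = incr p m' y by apply/eqP; rewrite eq_le mmin // m'min.
rewrite mE m'E !incr_i => /addrI/eqP; rewrite -subr_eq0 -mulrBl mulf_eq0.
rewrite -intrB intr_eq0 subr_eq0 (negbTE ij) /= => /eqP X0.
left; left; exists (- Y y).
have := mmin _ Sa; rewrite mE incr_i -/(X y) X0 mulr0 addr0 => Y0.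
split; first by rewrite oppr_ge0.
by rewrite {1}(dual_basis y) X0 sub0r /move_pt /= !mul0r !addr0.
Qed.

(** Off [p] on this ray [a] is strictly above both [b] and [c], hence irrelevant nearby; the weight
    is the lattice length of [c - b = n a], with [a] primitive. *)
Lemma tri_edge1 s : 0 < s -> box p e (move_pt p d1 s) ->
  edge_weight Phi (move_pt p d1 s) d1 n /\ tdist Phi (move_pt p d1 s) < tdist Phi p.
Proof.
move=> s0 xe; have [X0 Y0] := XY_d1 s; set x := move_pt p d1 s in xe X0 Y0 *.
have [|e1 [e10 h1]] := @incr_pos_near R p x (a.1 - b.1, a.2 - b.2).
  have -> : incr p (a.1 - b.1, a.2 - b.2) x = X x - Y x.
    by rewrite /X /Y /incr /lam_app /= !intrB; ring.
  by rewrite X0 Y0 sub0r opprK.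
have [|e2 [e20 h2]] := @incr_pos_near R p x (a.1 - c.1, a.2 - c.2).
  have -> : incr p (a.1 - c.1, a.2 - c.2) x = X x - incr p c x.
    by rewrite /X /incr /lam_app !intrB; ring.
  by rewrite incr_c X0 Y0 mulr0 addr0 sub0r opprK.
have [e3 [e30 h3]] := box_box xe.
split; last first.
  by rewrite (tdistE xe (tri_attains_b xe _ _)) -/(Y x) ?X0 ?Y0; lra.
have -> : n = lattice_length (vsub c b).
  transitivity (lattice_length (n%:Z * a.1, n%:Z * a.2)).
    by rewrite lattice_length_scale (lattice_length_unimodular ab) muln1.
  by congr lattice_length; rewrite /vsub /c /=; congr pair; ring.
have e0 : 0 < Num.min e1 (Num.min e2 e3) by rewrite !lt_min e10 e20.
have sub y : box x (Num.min e1 (Num.min e2 e3)) y ->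
    [/\ box p e y, Y y <= X y & incr p c y <= X y].
  move=> ye; have y1 : box x e1 y by apply: box_le ye; rewrite ge_min lexx.
  have y2 : box x e2 y by apply: box_le ye; rewrite !ge_min lexx orbT.
  have y3 : box x e3 y by apply: box_le ye; rewrite !ge_min lexx !orbT.
  split; first exact: h3.
    rewrite -subr_ge0; apply: le_trans (ltW (h1 _ y1)) _.
    by rewrite le_eqVlt; apply/orP; left; apply/eqP;
      rewrite /X /Y /incr /lam_app /= !intrB; ring.
  rewrite -subr_ge0; apply: le_trans (ltW (h2 _ y2)) _.
  by rewrite le_eqVlt; apply/orP; left; apply/eqP;
    rewrite /X /incr /lam_app !intrB; ring.
apply: (@edge_weight_two_forms R Phi p x d1 c b (tdist Phi p) _ (n%:R * dlt) e0).
- by rewrite mulf_neq0 // gt_eqF.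
- move=> z; transitivity (n%:R * (dlt * dlt) * lam_app a z); last first.
    by rewrite d1E /cross /lam_app /=; ring.
  by rewrite dlt2 /c /lam_app /= !intrD !intrM; ring.
- by rewrite incr_c X0 mulr0 addr0.
- move=> y /sub[ye YX cX] cb; apply: tdistE => //; apply: tri_attains_c => //.
    by rewrite -incr_c.
  by move: cb; rewrite incr_c gerDl pmulr_rle0.
- move=> y /sub[ye YX cX] bc; apply: tdistE => //; apply: tri_attains_b => //.
  by move: bc; rewrite incr_c lerDl pmulr_rge0.
Qed.

(** Here [X < 0], so [c] lies below [b] nearby and the tie is between [a] and [c]; [a - c] forms a
    lattice basis with [a], whence weight 1. *)
Lemma tri_edge2 s : 0 < s -> box p e (move_pt p d2 s) ->
  edge_weight Phi (move_pt p d2 s) d2 1 /\ tdist Phi (move_pt p d2 s) < tdist Phi p.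
Proof.
move=> s0 xe; have [X0 Y0] := XY_d2 s; set x := move_pt p d2 s in xe X0 Y0 *.
have ns : 0 < n%:R * s by rewrite mulr_gt0.
have [|e1 [e10 h1]] := @incr_pos_near R p x (b.1 - a.1, b.2 - a.2).
  have -> : incr p (b.1 - a.1, b.2 - a.2) x = Y x - X x.
    by rewrite /X /Y /incr /lam_app /= !intrB; ring.
  by rewrite X0 Y0; lra.
have [|e2 [e20 h2]] := @incr_pos_near R p x (- a.1, - a.2).
  have -> : incr p (- a.1, - a.2) x = - X x.
    by rewrite /X /incr /lam_app /= !intrN; ring.
  by rewrite X0 opprK.
have [e3 [e30 h3]] := box_box xe.
split; last first.
  by rewrite (tdistE xe (tri_attains_a xe _ _)) -/(X x) ?X0 ?Y0; lra.
have -> : 1%N = lattice_length (vsub a c).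
  apply/esym/(@lattice_length_unimodular _ a); rewrite (_ : det2 _ _ = det2 a b) //.
  by rewrite /det2 /vsub /c /=; ring.
have e0 : 0 < Num.min e1 (Num.min e2 e3) by rewrite !lt_min e10 e20.
have sub y : box x (Num.min e1 (Num.min e2 e3)) y ->
    [/\ box p e y, X y <= Y y & X y <= 0].
  move=> ye; have y1 : box x e1 y by apply: box_le ye; rewrite ge_min lexx.
  have y2 : box x e2 y by apply: box_le ye; rewrite !ge_min lexx orbT.
  have y3 : box x e3 y by apply: box_le ye; rewrite !ge_min lexx !orbT.
  split; first exact: h3.
    rewrite -subr_ge0; apply: le_trans (ltW (h1 _ y1)) _.
    by rewrite le_eqVlt; apply/orP; left; apply/eqP;
      rewrite /X /Y /incr /lam_app /= !intrB; ring.
  rewrite -oppr_ge0; apply: le_trans (ltW (h2 _ y2)) _.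
  by rewrite le_eqVlt; apply/orP; left; apply/eqP;
    rewrite /X /incr /lam_app /= !intrN; ring.
apply: (@edge_weight_two_forms R Phi p x d2 a c (tdist Phi p) _ dlt e0) => //.
- move=> z; transitivity (dlt * dlt * (lam_app a z - lam_app c z)).
    by rewrite dlt2 mul1r.
  by rewrite d2E d1E d3E /c /cross /lam_app /= !intrD !intrM; ring.
- by rewrite incr_c -/(X x) X0 Y0; ring.
- move=> y /sub[ye XY Xle0] ac; apply: tdistE => //; apply: tri_attains_a => //.
  by rewrite -incr_c.
- move=> y /sub[ye XY Xle0] ca; apply: tdistE => //; apply: tri_attains_c => //.
  by rewrite -incr_c.
Qed.

(** Here [X > 0], so [c] lies above [b] nearby and the tie is between [a] and [b], whose common
    increment [s] is positive; [b - a] and [a] form a lattice basis. *)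
Lemma tri_edge3 s : 0 < s -> box p e (move_pt p d3 s) ->
  edge_weight Phi (move_pt p d3 s) d3 1 /\ tdist Phi p < tdist Phi (move_pt p d3 s).
Proof.
move=> s0 xe; have [X0 Y0] := XY_d3 s; set x := move_pt p d3 s in xe X0 Y0 *.
have [|e1 [e10 h1]] := @incr_pos_near R p x a; first by rewrite -/(X x) X0.
have [e3 [e30 h3]] := box_box xe.
split; last first.
  by rewrite (tdistE xe (tri_attains_b xe _ _)) -/(Y x) ?X0 ?Y0; lra.
have -> : 1%N = lattice_length (vsub b a).
  apply/esym/(@lattice_length_unimodular _ a).
  rewrite (_ : det2 _ _ = - det2 a b); last by rewrite /det2 /vsub /=; ring.
  by case: ab => ->; [right|left].
have e0 : 0 < Num.min e1 e3 by rewrite !lt_min e10.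
have sub y : box x (Num.min e1 e3) y -> box p e y /\ 0 <= X y.
  move=> ye; have y1 : box x e1 y by apply: box_le ye; rewrite ge_min lexx.
  have y3 : box x e3 y by apply: box_le ye; rewrite !ge_min lexx !orbT.
  by split; [exact: h3|exact: ltW (h1 _ y1)].
apply: (@edge_weight_two_forms R Phi p x d3 b a (tdist Phi p) _ dlt e0) => //.
- move=> z; transitivity (dlt * dlt * (lam_app b z - lam_app a z)).
    by rewrite dlt2 mul1r.
  by rewrite d3E /cross /lam_app /=; ring.
- by rewrite -/(X x) -/(Y x) X0 Y0.
- by move=> y /sub[ye X_ge0] YX; apply: tdistE => //; exact: tri_attains_b.
- move=> y /sub[ye X_ge0] XY; apply: tdistE => //; apply: tri_attains_a => //.
  by apply: le_trans XY _; rewrite lerDl mulr_ge0.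
Qed.

Lemma move_pt_box (u : R * R) : exists eps : R, 0 < eps <= e /\
  forall s, 0 < s < eps -> box p e (move_pt p u s).
Proof.
have C0 : 0 < `|u.1| + `|u.2| + 1 by rewrite ltr_wpDl // addr_ge0.
exists (e / (`|u.1| + `|u.2| + 1)); split.
  rewrite divr_gt0 //= ler_pdivrMr // ler_peMr ?(ltW e_gt0) //.
  by rewrite lerDr addr_ge0.
move=> s /andP[s0]; rewrite ltr_pdivlMr // => se.
have u1 : s * `|u.1| <= s * (`|u.1| + `|u.2| + 1).
  by rewrite ler_pM2l // -addrA lerDl addr_ge0.
have u2 : s * `|u.2| <= s * (`|u.1| + `|u.2| + 1).
  by rewrite ler_pM2l // addrAC lerDr addr_ge0.
by split; rewrite /= [X in `|X|]addrAC subrr add0r normrM (gtr0_norm s0);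
  apply: le_lt_trans se.
Qed.

Lemma triangle_conclusion : exists eps : R, 0 < eps /\
    caustic Phi `&` box p eps = (ray p d1 `|` ray p d2 `|` ray p d3) `&` box p eps /\
    (forall s : R, 0 < s < eps ->
       edge_weight Phi (move_pt p d1 s) d1 n /\
       edge_weight Phi (move_pt p d2 s) d2 1 /\
       edge_weight Phi (move_pt p d3 s) d3 1 /\
       tdist Phi (move_pt p d1 s) < tdist Phi p /\
       tdist Phi (move_pt p d2 s) < tdist Phi p /\
       tdist Phi p < tdist Phi (move_pt p d3 s)).
Proof.
have [s1 [/andP[s10 s1e] H1]] := move_pt_box d1.
have [s2 [/andP[s20 s2e] H2]] := move_pt_box d2.
have [s3 [/andP[s30 s3e] H3]] := move_pt_box d3.
exists (Num.min s1 (Num.min s2 s3)); split; first by rewrite !lt_min s10 s20.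
split.
  have sub : box p (Num.min s1 (Num.min s2 s3)) `<=` box p e.
    by apply: box_le; rewrite ge_min s1e.
  by apply/seteqP; split => y [yK ye]; split => //; apply/(tri_caustic (sub _ ye)).
move=> s; rewrite !lt_min => /andP[s0 /andP[ss1 /andP[ss2 ss3]]].
have [w1 t1] : edge_weight Phi (move_pt p d1 s) d1 n /\
    tdist Phi (move_pt p d1 s) < tdist Phi p.
  by apply: tri_edge1 => //; apply: H1; rewrite s0.
have [w2 t2] : edge_weight Phi (move_pt p d2 s) d2 1 /\
    tdist Phi (move_pt p d2 s) < tdist Phi p.
  by apply: tri_edge2 => //; apply: H2; rewrite s0.
have [w3 t3] : edge_weight Phi (move_pt p d3 s) d3 1 /\
    tdist Phi p < tdist Phi (move_pt p d3 s).
  by apply: tri_edge3 => //; apply: H3; rewrite s0.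
by [].
Qed.

End Triangle.

(** * Local form of the caustic at a non-final vertex *)

Theorem theorem3p1 (R : realType) (Phi : set (R * R))
  (Hcompact : @compact (R * R)%type Phi) (Hconvex : convex_dom Phi)
  (Hint : @interior (R * R)%type Phi !=set0)
  (p : R * R) (Hvert : is_vertex (caustic Phi) p)
  (Hnonfinal : 0 < tdist Phi p < final_time Phi) :
  exists n : nat, (1 <= n)%N /\
  exists e1 e2 : int * int, (det2 e1 e2 = 1 \/ det2 e1 e2 = -1) /\
  let d1 := lat R e2 in
  let d2 := lat R ((- e1.1 - n%:Z * e2.1)%R, (- e1.2 - n%:Z * e2.2)%R) in
  let d3 := lat R e1 in
  exists eps : R, 0 < eps /\
    caustic Phi `&` box p eps = (ray p d1 `|` ray p d2 `|` ray p d3) `&` box p eps /\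
    (forall s : R, 0 < s < eps ->
       edge_weight Phi (move_pt p d1 s) d1 n /\
       edge_weight Phi (move_pt p d2 s) d2 1 /\
       edge_weight Phi (move_pt p d3 s) d3 1 /\
       tdist Phi (move_pt p d1 s) < tdist Phi p /\
       tdist Phi (move_pt p d2 s) < tdist Phi p /\
       tdist Phi p < tdist Phi (move_pt p d3 s)).
Proof.
have [[pint [l [m [lm [Sl Sm]]]]] _] := Hvert.
have Phip : Phi p by exact: interior_subset pint.
have [t0 tfin] := andP Hnonfinal.
have SK := attains_norm_minimal Hcompact Phip t0.
(* Non-finality enters here: any [q] of larger value gives the direction [q - p] of the open
   half-plane containing the attaining covectors. *)
have [|_ [q Phiq <-] tq] := sup_gt _ tfin; first by exists (tdist Phi p), p.
have Sv s : attains Phi p s -> 0 < lam_app s (q.1 - p.1, q.2 - p.2).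
  move=> [s0 sE]; have := tdist_le Hcompact Phiq s0.
  rewrite (supp_fun_shift _ _ p) [supp_fun Phi s p]sE => tq'.
  by rewrite -(ltrD2l (tdist Phi p)) addr0; exact: lt_le_trans tq tq'.
have [B SB] := attains_bounded Hcompact pint.
have [L LP] := int_vectors_bounded B.
have [a [b [Sa Sb D0 ext]]] :=
  half_plane_extremes SK (fun s Ss => LP s (SB s Ss)) Sv Sl Sm lm.
have Sn0 s : attains Phi p s -> s != (0, 0) by case.
have SBz s : attains Phi p s ->
    `|s.1| <= (Num.truncn B).+1%:Z /\ `|s.2| <= (Num.truncn B).+1%:Z.
  move=> /SB sB; have BN : B <= (Num.truncn B).+1%:Z%:~R by exact: ltW (truncnS_gt B).
  split; rewrite -(ler_int R) intr_norm; apply: le_trans (le_trans sB BN).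
    by rewrite /norm1 lerDl.
  by rewrite /norm1 lerDr.
have [/(segment_like_not_vertex Hcompact pint)//|] :=
  norm_minimal_classification SK Sn0 SBz Sa Sb D0 ext.
move=> [f1 [f2 [n [f12 n0 [Sf1 Sf2] Sf3 Sall]]]].
have [|e [e0 loc]] := attains_near Hcompact pint; first by exists l.
exists n; split => //; exists (tri_e1 f1 f2), (tri_e2 f1 f2).
split; first exact: tri_det.
exact: (triangle_conclusion f12 n0 Sf1 Sf2 Sf3 Sall e0 loc).
Qed.
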